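(* Let $\mathcal{X}=\{1,2,\dots,S\}$ be a state space of size $|\mathcal{X}|=S$. For every $\beta>0$ there exists a choice of parameters $\boldsymbol{\theta}$ of the MambaZero model on $\mathcal{X}$ with dimensions $N=S$, $d=2S$, $e=1$ and convolution window $w=2$, such that its output prediction exactly matches the add-$\beta$ (Laplacian) estimator for first-order Markov chains on $\mathcal{X}$; that is, for all sequences $(x_t)_{t\ge 1}$ in $\mathcal{X}$ and all $t\ge 1$, $$D_{\mathrm{KL}}\big(\mathbb{P}_\beta^{(1)}(\cdot\mid x_1^t)\,\big\|\,\mathbb{P}_{\boldsymbol{\theta}}(\cdot\mid x_1^t)\big)=0 .$$
   Context: Notation: $x_1^t=(x_1,\dots,x_t)$; $\mathrm{softplus}(z)=\log(1+e^z)$; $D_{\mathrm{KL}}(P\|Q)=\sum_j P(j)\log\frac{P(j)}{Q(j)}$ for probability distributions $P,Q$ on $\mathcal{X}$. Laplacian (add-$\beta$) estimator of order 1: for $j\in\mathcal{X}$, $$\mathbb{P}_\beta^{(1)}(x_{t+1}=j\mid x_1^t)=\frac{n_j+\beta}{n+S\beta},$$ where $n_j=|\{i: 2\le i\le t,\ (x_{i-1},x_i)=(x_t,j)\}|$ and $n=|\{i: 2\le i\le t,\ x_{i-1}=x_t\}|$. MambaZero model (positive integers $d,e,N,w$, alphabet $\mathcal{X}$ of size $S$). Its parameters $\boldsymbol{\theta}$ are: embedding vectors $\boldsymbol{e}_i\in\mathbb{R}^d$ ($i\in\mathcal{X}$); $a\ge 0$; $\boldsymbol{w}_\Delta\in\mathbb{R}^d$;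 $\delta\in\mathbb{R}$; $W_X\in\mathbb{R}^{ed\times d}$; $W_B,W_C\in\mathbb{R}^{N\times d}$; $W_o\in\mathbb{R}^{d\times ed}$; $W_\ell\in\mathbb{R}^{S\times d}$; and the kernels of three time-wise convolutions $\mathrm{conv}_X$ (on sequences in $\mathbb{R}^{ed}$), $\mathrm{conv}_B,\mathrm{conv}_C$ (on sequences in $\mathbb{R}^N$) of window $w$, with a separate kernel for each coordinate: for a sequence $(\boldsymbol{z}_t)_{t\ge1}$, the $i$-th coordinate of $\mathrm{conv}(\boldsymbol{z}_{t-w+1}^t)$ is $\sum_{s=0}^{w-1}\kappa_{i,s}\,z_{t-s,i}$ with learnable real weights $\kappa_{i,s}$, where $\boldsymbol{z}_r=0$ for $r\le 0$. On an input sequence $(x_t)_{t\ge1}$ in $\mathcal{X}$, the model computes, with $H_0=0\in\mathbb{R}^{ed\times N}$, for each $t\ge1$: $$\boldsymbol{x}_t=\boldsymbol{e}_{x_t},\quad \Delta_t=\mathrm{softplus}(\langle \boldsymbol{w}_\Delta,\boldsymbol{x}_t\rangle+\delta),\quad a_t=\exp(-a\,\Delta_t),$$ $$\tilde{\boldsymbol{x}}_t=\mathrm{conv}_X(W_X\boldsymbol{x}_{t-w+1}^t)\cdot\Delta_t,\quad \boldsymbol{b}_t=\mathrm{conv}_B(W_B\boldsymbol{x}_{t-w+1}^t),\quad \boldsymbol{c}_t=\mathrm{conv}_C(W_C\boldsymbol{x}_{t-w+1}^t)$$ (the matrices being applied to each vector of the window), $$H_t=a_tH_{t-1}+\tilde{\boldsymbol{x}}_t\boldsymbol{b}_t^\top,\quad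 \boldsymbol{y}_t=H_t\boldsymbol{c}_t,\quad \boldsymbol{o}_t=W_o\boldsymbol{y}_t,\quad \boldsymbol{u}_t=\boldsymbol{x}_t+\boldsymbol{o}_t,$$ $$\mathrm{logit}_t=W_\ell\boldsymbol{u}_t\in\mathbb{R}^S,\qquad \mathbb{P}_{\boldsymbol{\theta}}(\cdot\mid x_1^t)=\mathrm{logit}_t/\|\mathrm{logit}_t\|_1 .$$ The KL divergence is only meaningful when $\mathbb{P}_{\boldsymbol{\theta}}(\cdot\mid x_1^t)$ is a probability vector; its being one (i.e. $\mathrm{logit}_t$ nonzero with nonnegative entries) is part of the assertion. *)

(* Defs.v *)
From HB Require Import structures.
From mathcomp Require Import all_boot all_order all_algebra.
From mathcomp Require Import all_classical all_reals all_analysis.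
Set Implicit Arguments.
Unset Strict Implicit.
Unset Printing Implicit Defensive.
Import Order.TTheory GRing.Theory Num.Theory.
Local Open Scope ring_scope.

(* The alphabet {1, ..., S} is 'I_S.  Sequences (x_t)_{t >= 1} are functions on
   nat indexed from 1: the value at 0 is never used. *)

Definition softplus (R : realType) (z : R) : R := ln (1 + expR z).

(* Values in \bar R, with 0 log (0 / q) = 0 and p log (p / 0) = +oo for p != 0;
   the real-valued formula would make the latter 0, since p / 0 = 0 and
   ln 0 = 0. *)
Definition kl_div (R : realType) (S : nat) (P Q : 'I_S -> R) : \bar R :=
  (\sum_(j < S)
     (if P j == 0%R then 0
      else if Q j == 0%R then +oo
      else (P j * ln (P j / Q j))%:E))%E.

Section Laplace.
Variables (R : realType) (S : nat) (x : nat -> 'I_S) (t : nat).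

Definition trans_count (j : 'I_S) : nat :=
  #|[set i : 'I_t.+1 | (2 <= i)%N & (x i.-1, x i) == (x t, j)]|.

Definition state_count : nat :=
  #|[set i : 'I_t.+1 | (2 <= i)%N & x i.-1 == x t]|.

Definition laplace (beta : R) (j : 'I_S) : R :=
  ((trans_count j)%:R + beta) / (state_count%:R + S%:R * beta).

End Laplace.

(* kappa i s weighs the i-th coordinate of z_{t-s}; the condition s < t encodes
   z_r = 0 for r <= 0. *)
Definition time_conv (R : realType) (m w : nat) (kappa : 'M[R]_(m, w))
    (z : nat -> 'cV[R]_m) (t : nat) : 'cV[R]_m :=
  \col_(i < m) \sum_(s < w | (s < t)%N) kappa i s * z (t - s)%N i 0.

Record mamba_zero (R : realType) (S d e N w : nat) := MambaZero {
  mz_emb : 'I_S -> 'cV[R]_d;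
  mz_a : R;
  mz_a_ge0 : 0 <= mz_a;
  mz_wDelta : 'cV[R]_d;
  mz_delta : R;
  mz_WX : 'M[R]_(e * d, d);
  mz_WB : 'M[R]_(N, d);
  mz_WC : 'M[R]_(N, d);
  mz_Wo : 'M[R]_(d, e * d);
  mz_Wl : 'M[R]_(S, d);
  mz_kX : 'M[R]_(e * d, w);
  mz_kB : 'M[R]_(N, w);
  mz_kC : 'M[R]_(N, w)
}.

Section Forward.
Variables (R : realType) (S d e N w : nat) (theta : mamba_zero R S d e N w).
Variable x : nat -> 'I_S.

Definition mz_x (t : nat) : 'cV[R]_d := mz_emb theta (x t).

Definition mz_Delta (t : nat) : R :=
  softplus (((mz_wDelta theta)^T *m mz_x t) 0 0 + mz_delta theta).

Definition mz_decay (t : nat) : R := expR (- mz_a theta * mz_Delta t).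

Definition mz_xtilde (t : nat) : 'cV[R]_(e * d) :=
  mz_Delta t *: time_conv (mz_kX theta) (fun r => mz_WX theta *m mz_x r) t.

Definition mz_b (t : nat) : 'cV[R]_N :=
  time_conv (mz_kB theta) (fun r => mz_WB theta *m mz_x r) t.

Definition mz_c (t : nat) : 'cV[R]_N :=
  time_conv (mz_kC theta) (fun r => mz_WC theta *m mz_x r) t.

Fixpoint mz_H (t : nat) : 'M[R]_(e * d, N) :=
  if t is t'.+1 then mz_decay t *: mz_H t' + mz_xtilde t *m (mz_b t)^T else 0.

Definition mz_y (t : nat) : 'cV[R]_(e * d) := mz_H t *m mz_c t.
Definition mz_o (t : nat) : 'cV[R]_d := mz_Wo theta *m mz_y t.
Definition mz_u (t : nat) : 'cV[R]_d := mz_x t + mz_o t.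
Definition mz_logit (t : nat) : 'cV[R]_S := mz_Wl theta *m mz_u t.

Definition mz_pred (t : nat) (j : 'I_S) : R :=
  mz_logit t j 0 / \sum_(k < S) `|mz_logit t k 0|.

End Forward.

(* Main.v *)
Require Import Defs.
From HB Require Import structures.
From mathcomp Require Import all_boot all_order all_algebra.
From mathcomp Require Import all_classical all_reals all_analysis.
Set Implicit Arguments.
Unset Strict Implicit.
Unset Printing Implicit Defensive.
Import Order.TTheory GRing.Theory Num.Theory.
Local Open Scope ring_scope.

(** Take a = 0 and w_Delta = 0, so that nothing is forgotten and Delta is a
    positive constant D.  Embed states as one-hot vectors in the first half of
    the 2S coordinates, and let the convolutions select x_t for X and C, and
    x_{t-1} for B.  Then H_t is D times the matrix of transition counts (the
    zero padding makes b_1 = 0, so that t = 1 is not counted as a transition),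
    and H_t c_t is its column of index x_t.  W_o moves this column, divided by
    D, to the second half of the coordinates, where it does not interfere with
    x_t; finally W_l adds it to the vector with all entries beta, produced from
    the one-hot vector in the first half.  Thus logit_t has entries n_j + beta. *)

(** Each earlier visit to [x t] has exactly one successor. This is what makes the normalising
    constant of the logits agree with the Laplace denominator. *)
Lemma sum_trans_count (S : nat) (x : nat -> 'I_S) (t : nat) :
  (\sum_(j < S) trans_count x t j = state_count x t)%N.
Proof.
rewrite /state_count -sum1_card (partition_big (fun i : 'I_t.+1 => x i) predT) //=.
apply: eq_bigr => j _; rewrite /trans_count -sum1_card; apply: eq_bigl => i.
by rewrite !inE xpair_eqE andbA.
Qed.

Lemma kl_div_refl (R : realType) (S : nat) (P : 'I_S -> R) :
  kl_div P P = 0%E.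
Proof.
rewrite /kl_div big1 // => j _; case: eqP => // /eqP Pj0.
by rewrite divff // ln1 mulr0.
Qed.

Lemma softplus_gt0 (R : realType) (z : R) : 0 < softplus z.
Proof. by rewrite ln_gt0 // ltrDl expR_gt0. Qed.

Definition lag_kernel (R : realType) (m w : nat) (s0 : 'I_w) : 'M[R]_(m, w) :=
  \matrix_(i, s) (s == s0)%:R.

Lemma time_conv_lag (R : realType) (m w : nat) (s0 : 'I_w)
    (z : nat -> 'cV[R]_m) (t : nat) :
  time_conv (lag_kernel R m s0) z t = if (s0 < t)%N then z (t - s0)%N else 0.
Proof.
apply/colP => i; rewrite mxE; case: ifPn => [lt_s0t|ge_s0t].
  rewrite (bigD1 s0) //= mxE eqxx mul1r big1 ?addr0 // => s /andP[_ /negPf ns].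
  by rewrite mxE ns mul0r.
(* The only nonzero weight sits at lag [s0], which the guard [s < t] excludes here. *)
rewrite mxE big1 // => s lt_st; rewrite mxE; case: eqP lt_st => [->|_ _].
  by rewrite (negPf ge_s0t).
by rewrite mul0r.
Qed.

Definition incl_mx (R : realType) (m n : nat) (f : 'I_m -> 'I_n) : 'M[R]_(n, m) :=
  \matrix_(k, i) (k == f i)%:R.

Lemma tr_incl_mx_mul (R : realType) (m p n : nat)
    (f : 'I_m -> 'I_n) (g : 'I_p -> 'I_n) :
  (incl_mx R f)^T *m incl_mx R g = \matrix_(i, j) (f i == g j)%:R.
Proof.
apply/matrixP => i j; rewrite !mxE (bigD1 (f i)) //= !mxE eqxx mul1r.
rewrite big1 ?addr0 // => k /negPf nk.
by rewrite !mxE nk mul0r.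
Qed.

Lemma tr_incl_mxK (R : realType) (m n : nat) (f : 'I_m -> 'I_n) :
  injective f -> (incl_mx R f)^T *m incl_mx R f = 1%:M.
Proof.
move=> f_inj; rewrite tr_incl_mx_mul; apply/matrixP => i j.
by rewrite !mxE (inj_eq f_inj).
Qed.

Section CountingModel.
Variables (R : realType) (S : nat) (beta : R).

Lemma leq_double_dim : (S <= 2 * S)%N.
Proof. by rewrite leq_pmull. Qed.

Lemma leq_inner_dim : (S <= 1 * (2 * S))%N.
Proof. by rewrite mul1n leq_double_dim. Qed.

Lemma second_half_lt (i : 'I_S) : (S + i < 2 * S)%N.
Proof. by rewrite mul2n -addnn ltn_add2l. Qed.

(** [L] and [U] are isometries onto the two halves of the embedding space. [J] is the analogue of
    [L] for the inner space, whose dimension [1 * (2 * S)] is not convertible to [2 * S]. *)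
Let L : 'M[R]_(2 * S, S) := incl_mx R (widen_ord leq_double_dim).
Let U : 'M[R]_(2 * S, S) := incl_mx R (fun i => Ordinal (second_half_lt i)).
Let J : 'M[R]_(1 * (2 * S), S) := incl_mx R (widen_ord leq_inner_dim).
Let D : R := softplus 0.

Let onehot (i : 'I_S) : 'cV[R]_S := delta_mx i 0.

Definition counting_model : mamba_zero R S (2 * S) 1 S 2 :=
  MambaZero (fun i => L *m onehot i) (lexx 0) 0 0
    (J *m L^T) L^T L^T (D^-1 *: (U *m J^T))
    (beta *: (const_mx 1 *m L^T) + U^T)
    (lag_kernel R _ ord0) (lag_kernel R _ ord_max) (lag_kernel R _ ord0).

Let LTL : L^T *m L = 1%:M.
Proof. by apply: tr_incl_mxK => i j [] /val_inj. Qed.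

Let UTU : U^T *m U = 1%:M.
Proof. by apply: tr_incl_mxK => i j [] /addnI /val_inj. Qed.

Let JTJ : J^T *m J = 1%:M.
Proof. by apply: tr_incl_mxK => i j [] /val_inj. Qed.

Let LTU : L^T *m U = 0.
Proof.
rewrite tr_incl_mx_mul; apply/matrixP => i j; rewrite !mxE -val_eqE /=.
by rewrite ltn_eqF // ltn_addr.
Qed.

Let UTL : U^T *m L = 0.
Proof. by apply: trmx_inj; rewrite trmx_mul trmxK LTU trmx0. Qed.

Variable x : nat -> 'I_S.

Lemma counting_model_Delta (t : nat) : mz_Delta counting_model x t = D.
Proof. by rewrite /mz_Delta /= trmx0 mul0mx mxE addr0. Qed.

Lemma counting_model_decay (t : nat) : mz_decay counting_model x t = 1.
Proof. by rewrite /mz_decay /= oppr0 mul0r expR0. Qed.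

Lemma counting_model_xtilde (t : nat) : (0 < t)%N ->
  mz_xtilde counting_model x t = D *: (J *m onehot (x t)).
Proof.
move=> t_gt0; rewrite /mz_xtilde counting_model_Delta time_conv_lag t_gt0 subn0.
by rewrite /mz_x /= -mulmxA (mulmxA L^T) LTL mul1mx.
Qed.

Lemma counting_model_b (t : nat) :
  mz_b counting_model x t = if (1 < t)%N then onehot (x t.-1) else 0.
Proof.
rewrite /mz_b time_conv_lag /=; case: ifP => // _.
by rewrite /mz_x /= mulmxA LTL mul1mx subn1.
Qed.

Lemma counting_model_c (t : nat) : (0 < t)%N ->
  mz_c counting_model x t = onehot (x t).
Proof.
move=> t_gt0; rewrite /mz_c time_conv_lag t_gt0 subn0.
by rewrite /mz_x /= mulmxA LTL mul1mx.
Qed.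

Lemma counting_model_H (t : nat) :
  mz_H counting_model x t =
  D *: (J *m \sum_(i < t.+1 | (2 <= i)%N) delta_mx (x i) (x i.-1)).
Proof.
elim: t => [|t IHt].
  by rewrite /= big1 ?mulmx0 ?scaler0 // => -[[]].
rewrite [LHS]/= IHt counting_model_decay scale1r counting_model_xtilde //.
rewrite counting_model_b big_mkcond [in RHS]big_mkcond [in RHS]big_ord_recr /=.
rewrite mulmxDr scalerDr; congr (_ + _).
(* The new summand has index [t.+1], so its guard [2 <= i] is exactly the condition under which the
   lagged [mz_b] is not padding. *)
case: ifP => _; last by rewrite trmx0 !mulmx0 scaler0.
by rewrite trmx_delta -scalemxAl -mulmxA mul_delta_mx.
Qed.

Lemma counting_model_logit (t : nat) (j : 'I_S) : (0 < t)%N ->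
  mz_logit counting_model x t j 0 = (trans_count x t j)%:R + beta.
Proof.
move=> t_gt0; rewrite /mz_logit /mz_u /mz_o /mz_y counting_model_H.
rewrite counting_model_c // /mz_x /=.
set T := \sum_(i < _ | _) _.
have -> : D^-1 *: (U *m J^T) *m (D *: (J *m T) *m onehot (x t)) =
    U *m (T *m onehot (x t)).
  rewrite -!scalemxAl -scalemxAr scalerA mulVf ?gt_eqF ?softplus_gt0 // scale1r.
  by rewrite -!mulmxA (mulmxA J^T) JTJ mul1mx.
(* Of the four products, the two mixed ones vanish because the halves are orthogonal. *)
rewrite mulmxDr !mulmxDl -!scalemxAl -!mulmxA !(mulmxA L^T) !(mulmxA U^T).
rewrite LTL LTU UTL UTU !mul0mx !mul1mx mulmx0 scaler0 addr0 add0r.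
rewrite addrC mxE; congr (_ + _); last first.
  by rewrite -colE !mxE mulr1.
(* Entry [j] of column [x t] of [T] is a sum of indicators of the transition from [x t] to [j]. *)
rewrite -colE mxE summxE /trans_count -sum1_card natr_sum.
rewrite [RHS]big_mkcond [LHS]big_mkcond; apply: eq_bigr => i _.
rewrite inE mxE xpair_eqE; case: ltnP => //= _.
by rewrite andbC (eq_sym j) (eq_sym (x t)); case: (_ && _).
Qed.

End CountingModel.

Theorem theorem1 (R : realType) (S : nat) (hS : (0 < S)%N)
    (beta : R) (hbeta : 0 < beta) :
  exists theta : mamba_zero R S (2 * S) 1 S 2,
    forall (x : nat -> 'I_S) (t : nat), (1 <= t)%N ->
      [/\ mz_logit theta x t != 0,
          forall j : 'I_S, 0 <= mz_logit theta x t j 0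
        & kl_div (laplace x t beta) (mz_pred theta x t) = 0%E].
Proof.
exists (counting_model S beta) => x t t_gt0.
have logit_gt0 j : 0 < mz_logit (counting_model S beta) x t j 0.
  by rewrite counting_model_logit // ltr_wpDl.
split=> [|j|]; last 1 first.
- suff -> : mz_pred (counting_model S beta) x t = laplace x t beta.
    exact: kl_div_refl.
  apply/funext => j; rewrite /mz_pred /laplace counting_model_logit //.
  (* Both denominators become the sum over [k] of [trans_count x t k] plus [beta]; positivity of the
     logits removes the absolute values. *)
  congr (_ / _); rewrite -sum_trans_count natr_sum.
  rewrite mulr_natl -[S in beta *+ S]card_ord -sumr_const -big_split /=.
  by apply: eq_bigr => k _; rewrite gtr0_norm // counting_model_logit.
(* [hS] supplies a coordinate at which the logit is positive. *)
- apply/eqP => logit0; have := logit_gt0 (Ordinal hS).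
  by rewrite logit0 mxE ltxx.
- exact/ltW.
Qed.
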